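(* Let $R$ be a unitary ring with involution $*$. The following conditions are equivalent: (1) each element in $R$ has at most one weak group inverse; (2) each idempotent element in $R$ has a unique weak group inverse; (3) for any idempotents $e,f\in R$, if $eR=fR$ and $e^{*}f=e^{*}e$, then $e=f$; (4) for any idempotent $e\in R$ and any $x\in R$, if $e^{*}ex(1-e)=0$, then $ex(1-e)=0$.
   Context: $R$ is an associative ring with identity $1$ equipped with an involution, i.e. a map $a\mapsto a^{*}$ with $(a+b)^{*}=a^{*}+b^{*}$, $(ab)^{*}=b^{*}a^{*}$, $(a^{*})^{*}=a$ for all $a,b\in R$. $\mathbb{N}^{+}$ is the set of positive integers. For $a\in R$, $aR=\{ax: x\in R\}$. An element $e\in R$ is idempotent if $e^2=e$. Weak group inverse: for $a\in R$, an element $x\in R$ is called a weak group inverse of $a$ if there exists $k\in\mathbb{N}^{+}$ such that $xa^{k+1}=a^{k}$, $ax^{2}=x$, and $(a^{k})^{*}a^{2}x=(a^{k})^{*}a$. An element may have more than one weak group inverse. *)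

(* Defs.v *)
From HB Require Import structures.
From mathcomp Require Import all_boot all_order all_algebra.

Set Implicit Arguments.
Unset Strict Implicit.
Unset Printing Implicit Defensive.

Import GRing.Theory.
Local Open Scope ring_scope.

(* [pzRingType] does not require 1 != 0, so the zero ring is allowed. *)
Definition ring_involution (R : pzRingType) (star : R -> R) : Prop :=
  [/\ forall a b, star (a + b) = star a + star b,
      forall a b, star (a * b) = star b * star a
    & forall a, star (star a) = a].

Definition idempotent_elt (R : pzRingType) (e : R) : Prop := e ^+ 2 = e.

Definition in_right_ideal (R : pzRingType) (a y : R) : Prop :=
  exists x : R, y = a * x.

(* a R = b R, as equality of subsets of R. *)
Definition eq_right_ideal (R : pzRingType) (a b : R) : Prop :=
  forall y : R, in_right_ideal a y <-> in_right_ideal b y.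

Definition weak_group_inverse (R : pzRingType) (star : R -> R) (a x : R) :
    Prop :=
  exists k : nat,
    [/\ (0 < k)%N,
        x * a ^+ k.+1 = a ^+ k,
        a * x ^+ 2 = x
      & star (a ^+ k) * a ^+ 2 * x = star (a ^+ k) * a].

(* Main.v *)
Require Import Defs.
From HB Require Import structures.
From mathcomp Require Import all_boot all_order all_algebra.

Set Implicit Arguments.
Unset Strict Implicit.
Unset Printing Implicit Defensive.

Import GRing.Theory.
Local Open Scope ring_scope.

(** An idempotent [e] is a weak group inverse of itself, and so is every
    idempotent [f] with [fR = eR] and [e^* f = e^* e].  Uniqueness of weak group
    inverses of idempotents therefore identifies such [e] and [f].  The
    idempotents generating the right ideal [eR] are exactly the elements
    [e + ex(1 - e)], which turns the identification of [e] with [f] into the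
    cancellation property [e^* e x (1 - e) = 0 -> e x (1 - e) = 0].

    The substantial step is that this cancellation makes weak group inverses
    unique.  If [x] and [y] are weak group inverses of [a], take an exponent [n]
    that serves both.  Both elements lie in [a^n R]
    ([weak_group_inverse_right_ideal]), and on that right ideal left
    multiplication by [x], or by [y], undoes left multiplication by [a]
    ([left_inverse_on_right_ideal]).  Hence [e = ax] is an idempotent acting as
    a left identity on [a^n R].  The tempting candidate [ax - ay] is off by one
    factor [a]: the defining equations give
    [(a^n)^* a^2 x = (a^n)^* a = (a^n)^* a^2 y], so the element to which
    cancellation applies is [w = a^2 (x - y)].  It satisfies [w = e w (1 - e)]
    and [e^* w = 0], whence [w = 0], and multiplying twice by [x] on the left
    removes the factor [a^2] and leaves [x = y]. *)

Lemma idempotent_right_ideal_id (R : pzRingType) (e y : R) :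
  idempotent_elt e -> in_right_ideal e y -> e * y = y.
Proof. by rewrite /idempotent_elt expr2 => ee [z ->]; rewrite mulrA ee. Qed.

Lemma left_mul_pow_le (R : pzRingType) (a x : R) k n :
  (k <= n)%N -> x * a ^+ k.+1 = a ^+ k -> x * a ^+ n.+1 = a ^+ n.
Proof. by move=> /subnKC <- xa; rewrite -addSn !exprD mulrA xa. Qed.

Lemma left_inverse_on_right_ideal (R : pzRingType) (a x z : R) n :
  x * a ^+ n.+1 = a ^+ n -> in_right_ideal (a ^+ n) z -> x * (a * z) = z.
Proof. by move=> xa [t ->]; rewrite (mulrA a) -exprS mulrA xa. Qed.

(** Substituting [x = a x^2] into itself repeatedly produces arbitrarily high
    powers of [a] on the left. *)
Lemma weak_group_inverse_right_ideal (R : pzRingType) (a x : R) n :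
  a * x ^+ 2 = x -> in_right_ideal (a ^+ n) x.
Proof.
move=> axx; exists (x ^+ n.+1); elim: n => [|n IHn]; first by rewrite mul1r.
rewrite {1}IHn [a ^+ n.+1]exprSr -mulrA; congr (_ * _).
by rewrite -[n.+2]/(2 + n)%N exprD mulrA axx -exprS.
Qed.

Lemma in_right_ideal_mul_pow (R : pzRingType) (a z : R) n :
  in_right_ideal (a ^+ n) z -> in_right_ideal (a ^+ n) (a * z).
Proof. by case=> t ->; exists (a * t); rewrite !mulrA -exprS exprSr. Qed.

Lemma star_pow_le_mul_eq (R : pzRingType) (star : R -> R) (a u v : R) k n :
  ring_involution star -> (k <= n)%N -> star (a ^+ k) * u = star (a ^+ k) * v ->
  star (a ^+ n) * u = star (a ^+ n) * v.
Proof.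
case=> _ starM _ /subnKC <- uv.
by rewrite exprD starM -!mulrA uv.
Qed.

Lemma weak_group_inverse_idempotent (R : pzRingType) (star : R -> R) (e f : R) :
  e * e = e -> f * e = e -> e * f = f -> f * f = f ->
  star e * f = star e * e -> weak_group_inverse star e f.
Proof.
move=> ee fe ef ff sef; exists 1%N.
by split=> //; rewrite ?expr1 !expr2 ?ee ?ff // -mulrA ef.
Qed.

Lemma idempotent_weak_group_inverse_self (R : pzRingType) (star : R -> R) (e : R) :
  idempotent_elt e -> weak_group_inverse star e e.
Proof.
by rewrite /idempotent_elt expr2 => ee; apply: weak_group_inverse_idempotent.
Qed.

Lemma idempotent_add_corner (R : pzRingType) (e x : R) :
  e * e = e -> let f := e + e * x * (1 - e) in
  [/\ f * e = e, e * f = f & f * f = f].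
Proof.
move=> ee f.
have fe : f * e = e.
  by rewrite mulrDl ee -mulrA mulrBl mul1r ee subrr mulr0 addr0.
have ef : e * f = f by rewrite mulrDr !mulrA ee.
by split=> //; rewrite -{2}ef mulrA fe ef.
Qed.

(** Cancellation is applied to the idempotent [e = ax] and the element
    [w = a^2 (x - y)] of [eR].  Since [e] lies in [a^n R], its adjoint ends with
    the factor [(a^n)^*], which kills [w]. *)
Lemma weak_group_inverse_unique_of_cancel (R : pzRingType) (star : R -> R) :
  ring_involution star ->
  (forall e x : R, idempotent_elt e ->
     star e * e * x * (1 - e) = 0 -> e * x * (1 - e) = 0) ->
  forall a x y : R,
    weak_group_inverse star a x -> weak_group_inverse star a y -> x = y.
Proof.
move=> hstar; have [_ starM _] := hstar.
move=> cancel a x y [k [_ xa axx sx]] [l [_ ya ayy sy]].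
(* The defining equations persist when the exponent grows. *)
pose n := maxn k l.
have {}xa : x * a ^+ n.+1 = a ^+ n by apply: left_mul_pow_le xa; apply: leq_maxl.
have {}ya : y * a ^+ n.+1 = a ^+ n by apply: left_mul_pow_le ya; apply: leq_maxr.
have {}sx : star (a ^+ n) * (a ^+ 2 * x) = star (a ^+ n) * a.
  by apply: star_pow_le_mul_eq hstar (leq_maxl k l) _; rewrite mulrA.
have {}sy : star (a ^+ n) * (a ^+ 2 * y) = star (a ^+ n) * a.
  by apply: star_pow_le_mul_eq hstar (leq_maxr k l) _; rewrite mulrA.
have xI : in_right_ideal (a ^+ n) x by apply: weak_group_inverse_right_ideal.
have yI : in_right_ideal (a ^+ n) y by apply: weak_group_inverse_right_ideal.
have axI := in_right_ideal_mul_pow xI; have ayI := in_right_ideal_mul_pow yI.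
have xK z : in_right_ideal (a ^+ n) z -> x * (a * z) = z.
  exact: left_inverse_on_right_ideal.
have yK z : in_right_ideal (a ^+ n) z -> y * (a * z) = z.
  exact: left_inverse_on_right_ideal.
pose e := a * x; pose w := a ^+ 2 * (x - y).
have idem_e : idempotent_elt e by rewrite /idempotent_elt expr2 -mulrA xK.
(* [xax = x] and [yax = x], since [x] and [y] both undo [a] on [x]. *)
have we0 : w * e = 0 by rewrite -mulrA mulrBl xK // yK // subrr mulr0.
have xw : x * w = a * (x - y).
  by rewrite /w expr2 -(mulrA a a) !mulrBr xK // xK.
have ew : e * w = w by rewrite -mulrA xw mulrA.
have sw : star (a ^+ n) * w = 0 by rewrite /w !mulrBr sx sy subrr.
have sew : star e * w = 0.
  by have [t et] := axI; rewrite /e et starM -mulrA sw mulr0.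
have w0 : w = 0.
  have := cancel e w idem_e.
  rewrite -(mulrA (star e)) ew sew mul0r mulrBr mulr1 we0 subr0.
  by apply.
apply/subr0_eq; have : x * (x * w) = x - y.
  by rewrite xw !mulrBr xK // xK.
by rewrite w0 !mulr0.
Qed.

Theorem theorem3p5 (R : pzRingType) (star : R -> R)
    (hstar : ring_involution star) :
  [<->
    forall a x y : R,
      weak_group_inverse star a x -> weak_group_inverse star a y -> x = y;
    forall e : R, idempotent_elt e ->
      exists! x : R, weak_group_inverse star e x;
    forall e f : R, idempotent_elt e -> idempotent_elt f ->
      eq_right_ideal e f -> star e * f = star e * e -> e = f;
    forall e x : R, idempotent_elt e ->
      star e * e * x * (1 - e) = 0 -> e * x * (1 - e) = 0].
Proof.
tfae.
- move=> uniq e idem_e; exists e.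
  have ewgi := idempotent_weak_group_inverse_self star idem_e.
  by split=> // x; apply: uniq.
- move=> uniq e f idem_e idem_f efR sef.
  have ef : e * f = f.
    apply: idempotent_right_ideal_id => //.
    by apply/efR; exists 1; rewrite mulr1.
  have fe : f * e = e.
    apply: idempotent_right_ideal_id => //.
    by apply/efR; exists 1; rewrite mulr1.
  have [x [_ xuniq]] := uniq e idem_e.
  rewrite -(xuniq e); last exact: idempotent_weak_group_inverse_self.
  by apply: xuniq; apply: weak_group_inverse_idempotent; rewrite -?expr2.
- move=> eq_gen e x; rewrite /idempotent_elt expr2 => ee sex.
  have [fe ef ff] := idempotent_add_corner x ee.
  set f := e + _ in fe ef ff.
  have efR : eq_right_ideal e f.
    by move=> y; split=> -[z ->]; [exists (e * z) | exists (f * z)];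
       rewrite mulrA ?fe ?ef.
  have sef : star e * f = star e * e.
    by rewrite mulrDr !mulrA sex addr0.
  have e_eq_f : e = f by apply: eq_gen; rewrite /idempotent_elt ?expr2.
  by apply: (addrI e); rewrite addr0 -/f.
- exact: weak_group_inverse_unique_of_cancel.
Qed.
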